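(* Let $\ell$ and $n$ be positive integers with $\ell\leqslant n$, and let $r$ be the remainder on dividing $n$ by $\ell$, i.e. $n=\lfloor n/\ell\rfloor\ell+r$ with $0\leqslant r<\ell$. Define $\mathbf{d}=(d_1,\ldots,d_\ell)$ by $d_i=\lfloor n/\ell\rfloor$ for $1\leqslant i\leqslant \ell-r$ and $d_i=\lfloor n/\ell\rfloor+1$ for $\ell-r<i\leqslant \ell$, and put $|\mathbf{d}|^2=\sum_{i=1}^{\ell}d_i^2$. Then $$M(\ell,n)=\tfrac12\left(n^2-|\mathbf{d}|^2\right)+1=\frac12\left(n^2-(\ell-r)\left\lfloor\frac n\ell\right\rfloor^2-r\left(\left\lfloor\frac n\ell\right\rfloor+1\right)^2\right)+1=\frac{n^2(\ell-1)}{2\ell}+\frac12\left(\frac{r^2}{\ell}-r\right)+1.$$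
   Context: For positive integers $\ell,n$, $$M(\ell,n)=\max\Big\{\tfrac12\Big(n^2-\sum_{i=1}^{\ell}k_i^2\Big)+1 : k_1,\ldots,k_\ell \text{ nonnegative integers with } \sum_{i=1}^{\ell}k_i=n\Big\}.$$ *)

(* Defs.v *)
From mathcomp Require Import all_boot all_order all_algebra.
Set Implicit Arguments.
Unset Strict Implicit.
Unset Printing Implicit Defensive.
Import Order.TTheory GRing.Theory Num.Theory.
Local Open Scope ring_scope.

Definition sqnorm (l : nat) (k : 'I_l -> nat) : nat := (\sum_(i < l) k i ^ 2)%N.

Definition Mval (l n : nat) (k : 'I_l -> nat) : rat :=
  2^-1 * (n%:R ^+ 2 - (sqnorm k)%:R) + 1.

(* Nonnegative integers summing to n are at most n, so they are taken in        *)
(* 'I_n.+1 to make the index set finite. The default value 0 is never reached   *)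
(* when 0 < l, all the values being at least 1: see M_attained and M_ub.        *)
Definition M (l n : nat) : rat :=
  \big[Num.max/0]_(k : {ffun 'I_l -> 'I_n.+1} | (\sum_(i < l) k i)%N == n)
    Mval n (fun i => k i).

(* Indices are shifted by one: i ranges over 0, ..., l - 1. *)
Definition dvec (l n : nat) (i : 'I_l) : nat :=
  if (i < l - n %% l)%N then (n %/ l)%N else (n %/ l).+1.

Lemma eq_Mval (l n : nat) (k k' : 'I_l -> nat) : k =1 k' -> Mval n k = Mval n k'.
Proof.
by move=> kk'; rewrite /Mval /sqnorm; under eq_bigr => i _ do rewrite kk'.
Qed.

Lemma M_ub (l n : nat) (k : 'I_l -> nat) :
  (\sum_(i < l) k i)%N = n -> Mval n k <= M l n.
Proof.
move=> sk.
have le_k i : (k i < n.+1)%N by rewrite ltnS -sk (bigD1 i) //= leq_addr.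
pose f := [ffun i : 'I_l => Ordinal (le_k i)].
have fk : (fun i => f i : nat) =1 k by move=> i; rewrite ffunE.
rewrite -(eq_Mval n fk) /M (bigD1 f) /= ?le_max ?lexx //.
by under eq_bigr => i _ do rewrite fk; rewrite sk.
Qed.

Lemma sqnorm_le (l : nat) (k : 'I_l -> nat) :
  (sqnorm k <= (\sum_(i < l) k i) ^ 2)%N.
Proof.
rewrite /sqnorm; elim/big_rec2: _ => // i x y _ le_xy.
by rewrite sqrnD -addnA leq_add2l (leq_trans le_xy) // leq_addr.
Qed.

Lemma Mval_ge1 (l n : nat) (k : 'I_l -> nat) :
  (\sum_(i < l) k i)%N = n -> 1 <= Mval n k.
Proof.
move=> sk; rewrite /Mval lerDr mulr_ge0 // subr_ge0 -natrX ler_nat -sk.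
exact: sqnorm_le.
Qed.

Lemma M_attained (l n : nat) : (0 < l)%N ->
  exists2 k : 'I_l -> nat, (\sum_(i < l) k i)%N = n & M l n = Mval n k.
Proof.
move=> l_gt0; pose i0 := Ordinal l_gt0.
pose k0 (i : 'I_l) := if i == i0 then n else 0%N.
have sk0 : (\sum_(i < l) k0 i)%N = n.
  rewrite (bigD1 i0) //= {1}/k0 eqxx big1 ?addn0 // => i /negPf ne.
  by rewrite /k0 ne.
have M_gt0 : 0 < M l n.
  exact: lt_le_trans ltr01 (le_trans (Mval_ge1 sk0) (M_ub sk0)).
suff [M0|//] : M l n = 0 \/
    exists2 k : 'I_l -> nat, (\sum_(i < l) k i)%N = n & M l n = Mval n k.
  by rewrite M0 ltxx in M_gt0.
rewrite {1 2}/M; elim/big_rec: _ => [|f x /eqP sf IH]; first by left.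
by case: leP => _; [|right; exists (fun i => f i : nat)].
Qed.

(* Main.v *)
Require Import Defs.
From mathcomp Require Import all_boot all_order all_algebra.
From mathcomp Require Import zify ring.
Import Order.TTheory GRing.Theory Num.Theory.
Local Open Scope ring_scope.

(** With [q = n %/ l], every integer [k] satisfies [(k - q) * (k - q - 1) >= 0],
    with equality when [k] is [q] or [q + 1].  Summing over the [k_i], whose sum
    is fixed, bounds the sum of squares from below by a constant that [dvec]
    attains. *)

Lemma leq_consecutive_sqr (q k : nat) : (q.*2.+1 * k <= k ^ 2 + q * q.+1)%N.
(* For [k <= q] both factors [k - q] and [k - q - 1] are nonpositive; for [k > q] both are
   nonnegative. *)
Proof. by case: (leqP k q) => kq; nia. Qed.

Lemma consecutive_sqr_dvec (l n : nat) (i : 'I_l) : let q := (n %/ l)%N in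
  (q.*2.+1 * dvec n i = dvec n i ^ 2 + q * q.+1)%N.
Proof. by rewrite /dvec; case: ifP => _; nia. Qed.

(** A general [F] serves two uses: the identity yields the sum of the entries, squaring yields their
    squared norm. *)
Lemma sum_dvec_comp (l n : nat) (F : nat -> nat) : (0 < l)%N ->
  let r := (n %% l)%N in let q := (n %/ l)%N in
  (\sum_(i < l) F (dvec n i) = (l - r) * F q + r * F q.+1)%N.
Proof.
move=> l_gt0 r q; have r_le : (r <= l)%N by rewrite ltnW // ltn_pmod.
rewrite (eq_bigr (fun i : 'I_l => if (i < l - r)%N then F q else F q.+1));
  last by move=> i _; rewrite /dvec -/r -/q; case: ifP.
(* Over a range of naturals the sum can be cut at [l - r], where the value of [dvec] changes. *)
rewrite -(big_mkord xpredT (fun i => if (i < l - r)%N then F q else F q.+1)).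
rewrite (big_cat_nat (n := (l - r)%N)) ?leq_subr //=; congr (_ + _)%N.
  rewrite (eq_big_nat _ _ (F2 := fun=> F q)) => [|i /andP[_ ->] //].
  by rewrite sum_nat_const_nat subn0.
rewrite (eq_big_nat _ _ (F2 := fun=> F q.+1)) => [|i /andP[]]; last first.
  by rewrite leqNgt => /negPf ->.
by rewrite sum_nat_const_nat subKn.
Qed.

Lemma sum_dvec (l n : nat) : (0 < l)%N -> (\sum_(i < l) dvec n i = n)%N.
Proof.
move=> l_gt0; rewrite (sum_dvec_comp l n id l_gt0) /=.
have := divn_eq n l; have := ltn_pmod n l_gt0.
move: (n %/ l)%N (n %% l)%N => q r r_lt ->.
by rewrite mulnS addnCA -mulnDl subnK 1?ltnW // addnC mulnC.
Qed.

Lemma sqnorm_dvec_min (l n : nat) (k : 'I_l -> nat) : (0 < l)%N ->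
  (\sum_(i < l) k i = n)%N -> (sqnorm (@dvec l n) <= sqnorm k)%N.
Proof.
(* Adding [q * q.+1] for each index, with [q = n %/ l], makes the [dvec] side equal to
   [(2q + 1) * n]. *)
move=> l_gt0 sk; rewrite -(leq_add2r (\sum_(i < l) (n %/ l) * (n %/ l).+1)).
rewrite /sqnorm -!big_split /=.
under eq_bigr => i _ do rewrite -consecutive_sqr_dvec.
(* Only the factor [n] is turned back into the sum of the [k i]; its first occurrence sits inside
   [n %/ l]. *)
rewrite -big_distrr /= sum_dvec // -{2}sk big_distrr /=.
by apply: leq_sum => i _; apply: leq_consecutive_sqr.
Qed.

Theorem theorem31 (l n : nat) (hl : (0 < l)%N) (hn : (0 < n)%N)
    (hln : (l <= n)%N) :
  let r := (n %% l)%N in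
  let q := (n %/ l)%N in
  [/\ M l n = 2^-1 * (n%:R ^+ 2 - (sqnorm (@dvec l n))%:R) + 1,
      2^-1 * (n%:R ^+ 2 - (sqnorm (@dvec l n))%:R) + 1
      = 2^-1 * (n%:R ^+ 2 - (l%:R - r%:R) * q%:R ^+ 2
                - r%:R * (q%:R + 1) ^+ 2) + 1 :> rat
    & 2^-1 * (n%:R ^+ 2 - (l%:R - r%:R) * q%:R ^+ 2
              - r%:R * (q%:R + 1) ^+ 2) + 1
      = n%:R ^+ 2 * (l%:R - 1) / (2 * l%:R)
        + 2^-1 * (r%:R ^+ 2 / l%:R - r%:R) + 1 :> rat].
Proof.
move=> r q; split.
- apply/eqP; rewrite eq_le (M_ub (sum_dvec l n hl)) andbT.
  (* For the remaining upper bound, a maximizer [k] has squared norm at least that of [dvec]. *)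
  have [k sk ->] := M_attained n hl.
  by rewrite lerD2r ler_pM2l ?invr_gt0 // lerD2l lerN2 ler_nat sqnorm_dvec_min.
- rewrite /sqnorm (sum_dvec_comp l n (fun x => x ^ 2)%N hl) -/r -/q.
  (* This makes the truncated [l - r] cast to the rational difference. *)
  have r_le : (r <= l)%N by rewrite ltnW // ltn_pmod.
  rewrite (natrD _ (_ * _)%N) (natrM _ (l - r)%N) (natrM _ r) (natrB _ r_le).
  by rewrite (natrX _ q) (natrX _ q.+1) -(natr1 q) opprD addrA.
- have l_neq0 : l%:R != 0 :> rat by rewrite pnatr_eq0 -lt0n.
  (* Eliminating [n] leaves a rational identity in [q], [l] and [r]. *)
  have -> : n%:R = q%:R * l%:R + r%:R :> rat.
    by rewrite -natrM -natrD -divn_eq.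
  by field.
Qed.
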